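(* Let $n=3$, $\kappa=1$, $\eta,\chi_1,\chi_2\in\mathbb R$, and let $\gamma\in\mathbb R^3$ be a unit vector. Consider on $(T^*V_{3,2},\omega_\eta)$ the Hamiltonian flow of $$H=\tfrac12\langle \mathbf p_1,\mathbf p_1\rangle+\tfrac12\langle \mathbf p_2,\mathbf p_2\rangle-3\langle \mathbf p_1,\mathbf e_2\rangle\langle \mathbf p_2,\mathbf e_1\rangle+V_{II},\qquad V_{II}=\chi_1\langle\gamma,\mathbf e_1\rangle+\chi_2\langle\gamma,\mathbf e_2\rangle$$ (that is, $V_{II}=\chi_1\langle\gamma_1,\mathbf e_1\rangle+\chi_2\langle\gamma_2,\mathbf e_2\rangle$ with $\gamma_1=\gamma_2=\gamma$). Then, under the identification $V_{3,2}\cong SO(3)$, this flow represents the motion of a system Kowalevski top + gyrostat around a fixed point in the presence of the homogeneous gravitational field, where the inertia operator is $I=\operatorname{diag}(1,1,\tfrac12)$, the gyrostat momentum is $\mathbf L=(0,0,-\eta)$, and the position of the center of mass of the system body+gyrostat, multiplied by the mass $m$ of the system and the gravitational constant $g$, is $\chi=(\chi_1,\chi_2,0)$.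
   Context: **Phase space.** $V_{3,2}=\{(\mathbf e_1,\mathbf e_2)\in\mathbb R^{3}\times\mathbb R^3 : |\mathbf e_1|=|\mathbf e_2|=1,\ \langle \mathbf e_1,\mathbf e_2\rangle=0\}$. $T^*V_{3,2}$ is realized as the set of $(\mathbf e_1,\mathbf e_2,\mathbf p_1,\mathbf p_2)\in\mathbb R^{12}$ with $(\mathbf e_1,\mathbf e_2)\in V_{3,2}$, $\langle \mathbf e_1,\mathbf p_1\rangle=\langle \mathbf e_2,\mathbf p_2\rangle=0$, $\langle \mathbf e_1,\mathbf p_2\rangle+\langle \mathbf e_2,\mathbf p_1\rangle=0$. The twisted symplectic form $\omega_\eta$ is the restriction to $T^*V_{3,2}$ of $\sum_i(dp_1^i\wedge de_1^i+dp_2^i\wedge de_2^i)+\eta\sum_i de_1^i\wedge de_2^i$, with the sign convention that in the ambient space the Hamiltonian equations are $\dot{\mathbf e}_i=\partial H/\partial\mathbf p_i$, $\dot{\mathbf p}_1=-\partial H/\partial\mathbf e_1+\eta\,\partial H/\partial\mathbf p_2$, $\dot{\mathbf p}_2=-\partial H/\partial\mathbf e_2-\eta\,\partial H/\partial\mathbf p_1$. **Identification with $SO(3)$.** $(\mathbf e_1,\mathbf e_2)\mapsto R=(\mathbf e_1\ \mathbf e_2\ \mathbf e_3)\in SO(3)$, $\mathbf e_3=\mathbf e_1\times\mathbf e_2$; $R$ maps the frame attached to the body to the fixed frame. For $v\in\mathbb R^3$ let $\hat v$ be the skew matrix with $\hat v w=v\times w$. With $x\wedge y=xy^T-yx^T$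 and $\Phi_0=\mathbf p_1\wedge\mathbf e_1+\mathbf p_2\wedge\mathbf e_2$, the body momentum $\mathbf M$ is defined by $\hat{\mathbf M}=R^T\Phi_0R$, i.e. $M_1=\langle\mathbf p_2,\mathbf e_3\rangle$, $M_2=-\langle \mathbf p_1,\mathbf e_3\rangle$, $M_3=\langle\mathbf p_1,\mathbf e_2\rangle-\langle\mathbf p_2,\mathbf e_1\rangle$. $\Gamma=R^T\gamma$ is the vector $\gamma$ in the body frame. **Heavy rigid body with a gyrostat.** For inertia operator $I$, constant gyrostat momentum $\mathbf L$ in the body frame, and $\chi$ = position of the center of mass (body frame) multiplied by $mg$, the Euler–Poisson equations are $$\dot{\mathbf M}=(\mathbf M+\mathbf L)\times\Omega+\Gamma\times\chi,\qquad \dot\Gamma=\Gamma\times\Omega,\qquad \Omega=I^{-1}\mathbf M,$$ with $\Omega$ the angular velocity in the body frame, $\dot R=R\hat\Omega$. The Kowalevski top with a gyrostat is the case $I=\operatorname{diag}(1,1,\frac12)$, $\chi$ in the plane of the first two axes, $\mathbf L$ along the third axis. ''Represents'' means that, under the correspondence $(\mathbf e_1,\mathbf e_2,\mathbf p_1,\mathbf p_2)\leftrightarrow(R,\mathbf M)$, the Hamiltonian flow is given by these equations with $\Gamma=R^T\gamma$. *)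

(* Defs.v *)
From HB Require Import structures.
From mathcomp Require Import all_boot all_order all_algebra.
From mathcomp Require Import all_classical all_reals all_analysis.
From mathcomp Require Import ring lra.

Set Implicit Arguments.
Unset Strict Implicit.
Unset Printing Implicit Defensive.

Import Order.TTheory GRing.Theory Num.Theory.
Import numFieldNormedType.Exports.

Local Open Scope classical_set_scope.
Local Open Scope ring_scope.

(* R^3 is the space of columns.  The library norm on columns is the sup norm, *)
(* so Euclidean lengths are always expressed through [dot].                   *)
Definition dot (R : realType) (u v : 'cV[R]_3) : R := \sum_i u i 0 * v i 0.

Definition col3 (R : realType) (a b c : R) : 'cV[R]_3 :=
  \col_(i < 3) [:: a; b; c]`_i.

Definition cross (R : realType) (u v : 'cV[R]_3) : 'cV[R]_3 :=
  col3 (u 1 0 * v 2 0 - u 2 0 * v 1 0)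
       (u 2 0 * v 0 0 - u 0 0 * v 2 0)
       (u 0 0 * v 1 0 - u 1 0 * v 0 0).

Definition hat (R : realType) (v : 'cV[R]_3) : 'M[R]_3 :=
  \matrix_(i, j) cross v (delta_mx j 0) i 0.

(* Inverse of [hat] on skew-symmetric matrices. *)
Definition vee (R : realType) (A : 'M[R]_3) : 'cV[R]_3 :=
  col3 (A 2 1) (A 0 2) (A 1 0).

Definition diag3 (R : realType) (a b c : R) : 'M[R]_3 :=
  diag_mx (col3 a b c)^T.

Definition wedge (R : realType) (x y : 'cV[R]_3) : 'M[R]_3 :=
  x *m y^T - y *m x^T.

(* R^12, with points and tangent vectors written (e1, e2, p1, p2). *)
Notation phase R := ('cV[R]_3 * 'cV[R]_3 * 'cV[R]_3 * 'cV[R]_3)%type.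

Definition e1 (R : realType) (x : phase R) : 'cV[R]_3 := x.1.1.1.
Definition e2 (R : realType) (x : phase R) : 'cV[R]_3 := x.1.1.2.
Definition p1 (R : realType) (x : phase R) : 'cV[R]_3 := x.1.2.
Definition p2 (R : realType) (x : phase R) : 'cV[R]_3 := x.2.
Definition e3 (R : realType) (x : phase R) : 'cV[R]_3 := cross (e1 x) (e2 x).

Definition constraint (R : realType) (k : 'I_6) (x : phase R) : R :=
  [:: dot (e1 x) (e1 x) - 1;
      dot (e2 x) (e2 x) - 1;
      dot (e1 x) (e2 x);
      dot (e1 x) (p1 x);
      dot (e2 x) (p2 x);
      dot (e1 x) (p2 x) + dot (e2 x) (p1 x)]`_k.

Definition TstarV (R : realType) : set (phase R) :=
  [set x | forall k, constraint k x = 0].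

(* The six constraints have independent differentials along [TstarV], so the  *)
(* common kernel of these differentials is the tangent space.                 *)
Definition tangent (R : realType) (x : phase R) : set (phase R) :=
  [set X | forall k, 'd (@constraint R k) x X = 0].

(* sum_i (dp1^i /\ de1^i + dp2^i /\ de2^i) + eta sum_i de1^i /\ de2^i         *)
Definition omega (R : realType) (eta : R) (X Y : phase R) : R :=
  (dot (p1 X) (e1 Y) - dot (p1 Y) (e1 X))
  + (dot (p2 X) (e2 Y) - dot (p2 Y) (e2 X))
  + eta * (dot (e1 X) (e2 Y) - dot (e1 Y) (e2 X)).

(* The sign is the one for which the same relation, imposed for every Y in    *)
(* R^12, reads  e_i' = dH/dp_i,  p1' = - dH/de1 + eta dH/dp2,                  *)
(* p2' = - dH/de2 - eta dH/dp1.                                               *)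
Definition hamiltonian_vector (R : realType) (eta : R) (H : phase R -> R)
    (x X : phase R) : Prop :=
  tangent x X /\ forall Y, tangent x Y -> omega eta X Y = - 'd H x Y.

Definition integral_curve (R : realType) (eta : R) (H : phase R -> R)
    (J : set R) (x : R -> phase R) : Prop :=
  forall t, J t ->
    derivable x t 1 /\ hamiltonian_vector eta H (x t) ('D_1 x t).

Definition SO3 (R : realType) : set 'M[R]_3 :=
  [set Q | Q^T *m Q = 1%:M /\ \det Q = 1].

Definition frame (R : realType) (x : phase R) : 'M[R]_3 :=
  \matrix_(i < 3, j < 3) [:: e1 x; e2 x; e3 x]`_j i 0.

Definition Phi0 (R : realType) (x : phase R) : 'M[R]_3 :=
  wedge (p1 x) (e1 x) + wedge (p2 x) (e2 x).

(* Defined by hat M = frame^T Phi0 frame; see [hat_body_momentum].            *)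
Definition body_momentum (R : realType) (x : phase R) : 'cV[R]_3 :=
  vee ((frame x)^T *m Phi0 x *m frame x).

(* Rigid body with inertia operator I and gyrostat momentum L, moving about   *)
(* a fixed point; chi is m g times the centre of mass, gam the fixed vertical *)
(* direction, Q the attitude (body frame to fixed frame) and M the momentum.  *)
Definition heavy_gyrostat_motion (R : realType) (I : 'M[R]_3)
    (L chi gam : 'cV[R]_3) (J : set R)
    (Q : R -> 'M[R]_3) (M : R -> 'cV[R]_3) : Prop :=
  let Omega t := invmx I *m M t in
  let Gamma t := (Q t)^T *m gam in
  forall t, J t ->
    [/\ is_derive t 1 Q (Q t *m hat (Omega t)),
        is_derive t 1 M (cross (M t + L) (Omega t) + cross (Gamma t) chi)
      & is_derive t 1 Gamma (cross (Gamma t) (Omega t))].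

Definition hamiltonian (R : realType) (chi1 chi2 : R) (gam : 'cV[R]_3)
    (x : phase R) : R :=
  2^-1 * dot (p1 x) (p1 x) + 2^-1 * dot (p2 x) (p2 x)
  - 3 * dot (p1 x) (e2 x) * dot (p2 x) (e1 x)
  + (chi1 * dot gam (e1 x) + chi2 * dot gam (e2 x)).

Lemma forall_I3 (P : 'I_3 -> Prop) : P 0 -> P 1 -> P 2 -> forall i, P i.
Proof.
move=> P0 P1 P2 [[|[|[|//]]] lt_i3].
- by rewrite (_ : Ordinal _ = 0) //; apply/val_inj.
- by rewrite (_ : Ordinal _ = 1) //; apply/val_inj.
- by rewrite (_ : Ordinal _ = 2) //; apply/val_inj.
Qed.

Lemma sum_I3 (R : realType) (F : 'I_3 -> R) : \sum_i F i = F 0 + F 1 + F 2.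
Proof.
rewrite !big_ord_recl big_ord0 addr0 addrA.
by congr (F _ + F _ + F _); apply/val_inj.
Qed.

Lemma hatE (R : realType) (v w : 'cV[R]_3) : hat v *m w = cross v w.
Proof.
apply/matrixP => i j; rewrite ord1 mxE sum_I3 !mxE /=.
elim/forall_I3: i => /=; ring.
Qed.

Lemma hat_vee (R : realType) (A : 'M[R]_3) : A^T = - A -> hat (vee A) = A.
Proof.
move=> Askew; have sk i j : A i j = - A j i.
  by have := congr1 (fun B : 'M[R]_3 => B j i) Askew; rewrite !mxE.
have sk0 i : A i i = 0 by have := sk i i; lra.
apply/matrixP => i j; rewrite !mxE.
elim/forall_I3: i; elim/forall_I3: j; rewrite /= ?sk0; try ring.
all: rewrite [RHS]sk; ring.
Qed.

Lemma hat_body_momentum (R : realType) (x : phase R) :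
  hat (body_momentum x) = (frame x)^T *m Phi0 x *m frame x.
Proof.
apply: hat_vee.
have wedgeT (u v : 'cV[R]_3) : (wedge u v)^T = - wedge u v.
  by rewrite /wedge linearB /= !trmx_mul !trmxK opprB.
have Phi0T : (Phi0 x)^T = - Phi0 x.
  by rewrite /Phi0 opprD -!wedgeT; apply: linearD.
by rewrite !trmx_mul trmxK Phi0T mulNmx mulmxN mulmxA.
Qed.

(* Main.v *)
Require Import Defs.
From mathcomp Require Import all_boot all_order all_algebra.
From mathcomp Require Import all_classical all_reals all_analysis.
From mathcomp Require Import ring lra.

Set Implicit Arguments.
Unset Strict Implicit.
Unset Printing Implicit Defensive.

Import Order.TTheory GRing.Theory Num.Theory.
Import numFieldNormedType.Exports.

Local Open Scope classical_set_scope.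
Local Open Scope ring_scope.

(* The map phase_of sends (Q, M) to the point of T*V with frame Q and body    *)
(* momentum M, and moving the frame with body angular velocity w and M with   *)
(* velocity m gives exactly the tangent vectors dphase_of Q M w m.  In these  *)
(* coordinates the twisted form is                                            *)
(*   omega((w, m), (w', m')) = m.w' - m'.w - (M + L).(w x w')                 *)
(* with L = (0, 0, -eta), and dH(w, m) = Omega.m + (chi x Gamma).w with       *)
(* Omega = I^-1 M.  Comparing coefficients, the Hamiltonian vector is         *)
(*   w = Omega,   m = (M + L) x Omega + Gamma x chi,                          *)
(* which are the Euler-Poisson equations.                                     *)

(** Rotations preserve dot and cross products, so a frame Q turns every constraint and pairing into
    an identity between body components. In this left trivialization (Q, M) are global coordinates
    on T*V ([TstarV_phase_of], [phase_of_body]), and tangent vectors are the pairs (w, m)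
    ([tangent_dphase_of], [tangent_phase_of]). The eta term of the form equals eta times the third
    component of w x w', so the twist only shifts M by L: this is the gyrostat ([omega_dphase_of]).
    The Hamiltonian becomes (M1^2 + M2^2)/2 + M3^2 + chi.Gamma, whose quadratic part is half of
    M.I^-1 M with I = diag(1, 1, 1/2) ([diff_hamiltonian_dphase_of]). Testing against pure m' and
    pure w' determines the Hamiltonian vector ([hamiltonian_vectorP]); [is_derive_frame],
    [is_derive_body_momentum] and [is_derive_phase] carry this over to velocities of curves. *)

Section Coordinates.
Context {R : realType}.
Implicit Types (u v w : 'cV[R]_3) (Q : 'M[R]_3).

Lemma col3P v : v = col3 (v 0 0) (v 1 0) (v 2 0).
Proof. by apply/matrixP => i j; rewrite ord1 mxE; elim/forall_I3: i. Qed.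

(** Used as an eliminator: with [col3E] it reduces vector identities to scalar polynomial ones. *)
Lemma col3_ind (P : 'cV[R]_3 -> Prop) :
  (forall a b c, P (col3 a b c)) -> forall v, P v.
Proof. by move=> Pcol v; rewrite (col3P v). Qed.

Lemma dot_col3 (a b c a' b' c' : R) :
  dot (col3 a b c) (col3 a' b' c') = a * a' + b * b' + c * c'.
Proof. by rewrite /dot sum_I3 !mxE. Qed.

Lemma cross_col3 (a b c a' b' c' : R) :
  cross (col3 a b c) (col3 a' b' c') =
  col3 (b * c' - c * b') (c * a' - a * c') (a * b' - b * a').
Proof. by rewrite /cross !mxE. Qed.

Lemma add_col3 (a b c a' b' c' : R) :
  col3 a b c + col3 a' b' c' = col3 (a + a') (b + b') (c + c').
Proof. by apply/matrixP => i j; rewrite !mxE; elim/forall_I3: i. Qed.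

Lemma opp_col3 (a b c : R) : - col3 a b c = col3 (- a) (- b) (- c).
Proof. by apply/matrixP => i j; rewrite !mxE; elim/forall_I3: i. Qed.

Lemma col3_0 : 0 = col3 0 0 0 :> 'cV[R]_3.
Proof. by apply/matrixP => i j; rewrite !mxE; elim/forall_I3: i. Qed.

Definition col3E := (dot_col3, cross_col3, add_col3, opp_col3).

Lemma dotC u v : dot u v = dot v u.
Proof. by apply: eq_bigr => i _; rewrite mulrC. Qed.

Lemma dotDl u v w : dot (u + v) w = dot u w + dot v w.
Proof.
by rewrite /dot -big_split; apply: eq_bigr => i _; rewrite mxE mulrDl.
Qed.

Lemma dotNl u w : dot (- u) w = - dot u w.
Proof. by rewrite /dot -sumrN; apply: eq_bigr => i _; rewrite mxE mulNr. Qed.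

Lemma dot0l u : dot 0 u = 0.
Proof. by rewrite /dot big1 // => i _; rewrite mxE mul0r. Qed.

Lemma dotE u v : dot u v = (u^T *m v) 0 0.
Proof. by rewrite mxE; apply: eq_bigr => i _; rewrite mxE. Qed.

Lemma dot_mull Q u v : dot (Q *m u) v = dot u (Q^T *m v).
Proof. by rewrite !dotE trmx_mul mulmxA. Qed.

Lemma dot_orthogonal Q u v : Q^T *m Q = 1%:M -> dot (Q *m u) (Q *m v) = dot u v.
Proof. by move=> QQ; rewrite dot_mull mulmxA QQ mul1mx. Qed.

Lemma dot_eq u v : (forall w, dot u w = dot v w) -> u = v.
Proof.
elim/col3_ind: u => a b c; elim/col3_ind: v => a' b' c' e.
have := e (col3 1 0 0); have := e (col3 0 1 0); have := e (col3 0 0 1).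
rewrite !dot_col3 => *; congr col3; lra.
Qed.

Lemma det3E Q :
  \det Q = Q 0 0 * (Q 1 1 * Q 2 2 - Q 1 2 * Q 2 1)
         - Q 0 1 * (Q 1 0 * Q 2 2 - Q 1 2 * Q 2 0)
         + Q 0 2 * (Q 1 0 * Q 2 1 - Q 1 1 * Q 2 0).
Proof.
rewrite (expand_det_row _ 0) sum_I3 /cofactor.
rewrite !(expand_det_row _ ord0) !big_ord_recl !big_ord0 /cofactor !det_mx11.
rewrite !mxE.
(* Indices produced by [lift] are normalized through their values, so that [ring] recognizes equal
   entries. *)
have natE i j : Q i j = Q (inord (val i)) (inord (val j)) by rewrite !inord_val.
rewrite (natE 0 0) (natE 0 1) (natE 0 2) (natE 1 0) (natE 1 1) (natE 1 2).
rewrite (natE 2 0) (natE 2 1) (natE 2 2) !(natE (lift _ _)) /=; ring.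
Qed.

(** The cofactor identity, valid for every matrix as a polynomial identity; paired with a vector it
    says that triple products scale by the determinant. *)
Lemma cross_mul Q u v :
  Q^T *m cross (Q *m u) (Q *m v) = \det Q *: cross u v.
Proof.
apply/matrixP => i j; rewrite ord1 det3E mxE sum_I3 !mxE !sum_I3.
by elim/forall_I3: i => /=; ring.
Qed.

Lemma SO3_mulT Q : SO3 Q -> Q *m Q^T = 1%:M.
Proof. by move=> [/mulmx1C]. Qed.

Lemma SO3_mulKV Q u : SO3 Q -> Q *m (Q^T *m u) = u.
Proof. by move=> QSO3; rewrite mulmxA SO3_mulT // mul1mx. Qed.

Lemma cross_SO3 Q u v :
  SO3 Q -> cross (Q *m u) (Q *m v) = Q *m cross u v.
Proof.
move=> QSO3; have [_ detQ] := QSO3.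
by rewrite -[LHS](SO3_mulKV _ QSO3) cross_mul detQ scale1r.
Qed.

Lemma mulmx_col3 Q (a b c : R) :
  Q *m col3 a b c = a *: col 0 Q + b *: col 1 Q + c *: col 2 Q.
Proof. by apply/matrixP => i j; rewrite ord1 !mxE sum_I3 !mxE /=; ring. Qed.

Lemma hatT u : (hat u)^T = - hat u.
Proof.
apply/matrixP => i j; rewrite !mxE.
by elim/forall_I3: i; elim/forall_I3: j => /=; ring.
Qed.

Lemma crossC u v : cross u v = - cross v u.
Proof.
elim/col3_ind: u => a b c; elim/col3_ind: v => a' b' c'.
by rewrite !col3E; congr col3; ring.
Qed.

Lemma cross0r u : cross u 0 = 0.
Proof.
by elim/col3_ind: u => a b c; rewrite col3_0 !col3E; congr col3; ring.
Qed.

Lemma dot_cross u v w : dot u (cross v w) = dot (cross u v) w.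
Proof.
elim/col3_ind: u => ???; elim/col3_ind: v => ???; elim/col3_ind: w => ???.
by rewrite !col3E; ring.
Qed.

Lemma mul_wedge Q u v : wedge (Q *m u) (Q *m v) = Q *m wedge u v *m Q^T.
Proof. by rewrite /wedge !trmx_mul mulmxBr mulmxBl !mulmxA. Qed.

Implicit Types (x X Y : phase R) (M m : 'cV[R]_3).

(* On T*V the components of p1, p2 along e1, e2 vanish, except for            *)
(* <p1, e2> = - <p2, e1>, which is half of M3.                                *)
Definition body_p1 M : 'cV[R]_3 := col3 0 (M 2 0 / 2) (- M 1 0).
Definition body_p2 M : 'cV[R]_3 := col3 (- (M 2 0 / 2)) 0 (M 0 0).

Definition phase_of Q M : phase R :=
  (Q *m col3 1 0 0, Q *m col3 0 1 0, Q *m body_p1 M, Q *m body_p2 M).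

(** The product rule with Q' = Q hat w and M' = m: a component Q u moves with velocity Q (w x u +
    u'). *)
Definition dphase_of Q M w m : phase R :=
  (Q *m cross w (col3 1 0 0), Q *m cross w (col3 0 1 0),
   Q *m (cross w (body_p1 M) + body_p1 m),
   Q *m (cross w (body_p2 M) + body_p2 m)).

Lemma body_p1_col3 (a b c : R) : body_p1 (col3 a b c) = col3 0 (c / 2) (- b).
Proof. by rewrite /body_p1 !mxE. Qed.

Lemma body_p2_col3 (a b c : R) : body_p2 (col3 a b c) = col3 (- (c / 2)) 0 a.
Proof. by rewrite /body_p2 !mxE. Qed.

Lemma TstarV_phase_of Q M : SO3 Q -> TstarV (phase_of Q M).
Proof.
move=> [QQ _]; elim/col3_ind: M => a b c.
case=> [[|[|[|[|[|[|//]]]]]] lt_k6];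
  rewrite /constraint /e1 /e2 /p1 /p2 /= !dot_orthogonal //
    ?body_p1_col3 ?body_p2_col3 !dot_col3; ring.
Qed.

Lemma vee_wedge u v : vee (wedge u v) = cross v u.
Proof.
rewrite /vee /wedge /cross !mxE !big_ord1 !mxE.
by congr col3; ring.
Qed.

Lemma veeD (A B : 'M[R]_3) : vee (A + B) = vee A + vee B.
Proof. by rewrite [RHS]add_col3 /vee !mxE. Qed.

Lemma frame_mul Q u v :
  SO3 Q -> frame (Q *m col3 1 0 0, Q *m col3 0 1 0, u, v) = Q.
Proof.
move=> QSO3; apply/matrixP => i j; rewrite mxE /e3 /e1 /e2 /= cross_SO3 //.
rewrite cross_col3 !mulmx_col3.
by elim/forall_I3: j; rewrite /= !mxE; ring.
Qed.

(** Conjugation by Q cancels the rotation inside each wedge, and [vee] turns a wedge into a cross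
    product; M is thus linear in the body components of p1 and p2. *)
Lemma body_momentum_mul Q u v : SO3 Q ->
  body_momentum (Q *m col3 1 0 0, Q *m col3 0 1 0, Q *m u, Q *m v) =
  cross (col3 1 0 0) u + cross (col3 0 1 0) v.
Proof.
move=> QSO3; have [QQ _] := QSO3.
rewrite /body_momentum frame_mul // /Phi0 /e1 /e2 /p1 /p2 /=.
rewrite !mul_wedge -mulmxDl -mulmxDr !mulmxA QQ mul1mx -mulmxA QQ mulmx1.
by rewrite veeD !vee_wedge.
Qed.

Lemma frame_phase_of Q M : SO3 Q -> frame (phase_of Q M) = Q.
Proof. exact: frame_mul. Qed.

Lemma body_momentum_phase_of Q M : SO3 Q -> body_momentum (phase_of Q M) = M.
Proof.
move=> QSO3; rewrite body_momentum_mul //; elim/col3_ind: M => a b c.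
by rewrite body_p1_col3 body_p2_col3 !col3E; congr col3; field.
Qed.

Lemma TstarVP x : TstarV x ->
  [/\ dot (e1 x) (e1 x) = 1, dot (e2 x) (e2 x) = 1, dot (e1 x) (e2 x) = 0 &
  [/\ dot (e1 x) (p1 x) = 0, dot (e2 x) (p2 x) = 0 &
      dot (e1 x) (p2 x) + dot (e2 x) (p1 x) = 0]].
Proof.
move=> Vx; split; last split.
- by have := Vx 0; rewrite /constraint /= => /subr0_eq.
- by have := Vx 1; rewrite /constraint /= => /subr0_eq.
- exact: (Vx 2).
- exact: (Vx 3).
- exact: (Vx 4).
- exact: (Vx 5).
Qed.

(** Both the squared length of e1 x e2 and the determinant equal |e1|^2 |e2|^2 - (e1.e2)^2 by
    Lagrange's identity, hence 1. *)
Lemma frame_SO3 x : TstarV x -> SO3 (frame x).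
Proof.
move=> /TstarVP[]; rewrite /frame /e3.
elim/col3_ind: (e1 x) => a b c; elim/col3_ind: (e2 x) => a' b' c'.
rewrite cross_col3 !dot_col3 => n1 n2 n12 _; split.
  apply/matrixP => i j; rewrite mxE sum_I3 !mxE.
  have n3 : (b * c' - c * b') * (b * c' - c * b') +
    (c * a' - a * c') * (c * a' - a * c') +
    (a * b' - b * a') * (a * b' - b * a') = 1.
    transitivity ((a * a + b * b + c * c) * (a' * a' + b' * b' + c' * c') -
      (a * a' + b * b' + c * c') ^+ 2); first by ring.
    by rewrite n1 n2 n12; ring.
  by elim/forall_I3: i; elim/forall_I3: j; rewrite /= !mxE /=; lra.
rewrite det3E !mxE /=.
transitivity ((a * a + b * b + c * c) * (a' * a' + b' * b' + c' * c') -
      (a * a' + b * b' + c * c') ^+ 2); first by ring.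
by rewrite n1 n2 n12; ring.
Qed.

Lemma frame_col3 x (a b c : R) :
  frame x *m col3 a b c = a *: e1 x + b *: e2 x + c *: e3 x.
Proof.
rewrite mulmx_col3; congr (_ *: _ + _ *: _ + _ *: _).
- by apply/matrixP => i j; rewrite ord1 !mxE.
- by apply/matrixP => i j; rewrite ord1 !mxE.
- by apply/matrixP => i j; rewrite ord1 !mxE.
Qed.

Lemma frame_e1 x : e1 x = frame x *m col3 1 0 0.
Proof. by rewrite frame_col3 scale1r !scale0r !addr0. Qed.

Lemma frame_e2 x : e2 x = frame x *m col3 0 1 0.
Proof. by rewrite frame_col3 scale1r !scale0r add0r addr0. Qed.

Lemma body_momentumE x : TstarV x ->
  body_momentum x = cross (col3 1 0 0) ((frame x)^T *m p1 x)
                    + cross (col3 0 1 0) ((frame x)^T *m p2 x).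
Proof.
move=> Vx; have QSO3 := frame_SO3 Vx.
by rewrite -(body_momentum_mul _ _ QSO3) -frame_e1 -frame_e2 !SO3_mulKV.
Qed.

(** In body components the momentum constraints kill the first entry of p1 and the second of p2 and
    make the other two planar entries opposite; the three numbers left are read off from M. *)
Lemma phase_of_body x : TstarV x -> phase_of (frame x) (body_momentum x) = x.
Proof.
move=> Vx; have QSO3 := frame_SO3 Vx; have [QQ _] := QSO3.
have [_ _ _ []] := TstarVP Vx.
have xE : x = (frame x *m col3 1 0 0, frame x *m col3 0 1 0,
    frame x *m ((frame x)^T *m p1 x), frame x *m ((frame x)^T *m p2 x)).
  rewrite -frame_e1 -frame_e2 !SO3_mulKV // /e1 /e2 /p1 /p2.
  by case: (x) => [[[? ?] ?] ?].
rewrite -(SO3_mulKV (p1 x) QSO3) -(SO3_mulKV (p2 x) QSO3) frame_e1 frame_e2.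
rewrite !dot_orthogonal // => h1 h2 h3.
rewrite body_momentumE //; apply: etrans (esym xE); move: h1 h2 h3.
rewrite /phase_of.
elim/col3_ind: (_ *m p1 x) => a b c; elim/col3_ind: (_ *m p2 x) => a' b' c'.
rewrite !col3E body_p1_col3 body_p2_col3 => h1 h2 h3.
by congr pair; [congr pair |]; congr mulmx; congr col3; lra.
Qed.

End Coordinates.

(** * Differentials of the constraints and of the Hamiltonian *)

Section Differentials.
Context {R : realType}.

Lemma is_diff_fst (U V : normedModType R) (a : U * V) : is_diff a fst fst.
Proof.
pose f : {linear (U * V)%type -> U} := fst.
have cf : continuous f by move=> y; exact: cvg_fst.
have -> : fst = f by [].
by apply: DiffDef; [exact: linear_differentiable | rewrite diff_lin].
Qed.

Lemma is_diff_snd (U V : normedModType R) (a : U * V) : is_diff a snd snd.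
Proof.
pose f : {linear (U * V)%type -> V} := snd.
have cf : continuous f by move=> y; exact: cvg_snd.
have -> : snd = f by [].
by apply: DiffDef; [exact: linear_differentiable | rewrite diff_lin].
Qed.

Lemma is_diff_coord n (a : 'cV[R]_n) i :
  is_diff a (fun v : 'cV[R]_n => v i 0 : R) (fun v => v i 0).
Proof.
have @f : {linear 'cV[R]_n -> R}.
  by exists (fun v : 'cV[R]_n => v i 0); do 2![eexists]; do ?[constructor];
     rewrite ?mxE// => ? *; rewrite ?mxE//; move=> ?; rewrite !mxE.
have cf : continuous f by exact: coord_continuous.
have -> : (fun v : 'cV[R]_n => v i 0 : R) = f by [].
by apply: DiffDef; [exact: linear_differentiable | rewrite diff_lin].
Qed.

Lemma is_diff_dot (V : normedModType R) (f g df dg : V -> 'cV[R]_3) a :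
  is_diff a f df -> is_diff a g dg ->
  is_diff a (fun x => dot (f x) (g x))
    (fun X => dot (f a) (dg X) + dot (df X) (g a)).
Proof.
move=> df_f dg_g.
have cf i := is_diff_comp df_f (is_diff_coord (f a) i).
have cg i := is_diff_comp dg_g (is_diff_coord (g a) i).
have d01 := is_diffD (is_diffM (cf 0) (cg 0)) (is_diffM (cf 1) (cg 1)).
have d := is_diffD d01 (is_diffM (cf 2) (cg 2)).
pose c i (v : 'cV[R]_3) : R := v i 0.
have -> : (fun x => dot (f x) (g x)) =
    (c 0 \o f) * (c 0 \o g) + (c 1 \o f) * (c 1 \o g) + (c 2 \o f) * (c 2 \o g).
  by apply/funext => x; rewrite /dot sum_I3.
apply: is_diff_eq d _.
apply/funext => X; rewrite /dot !sum_I3 /=.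
rewrite !fctE /= /GRing.scale /=; ring.
Qed.

Implicit Types (x X Y : phase R).

Lemma is_diff_e1 x : is_diff x (@e1 R) (@e1 R).
Proof.
have dfst2 := is_diff_comp (is_diff_fst x) (is_diff_fst _).
exact: (is_diff_comp dfst2 (is_diff_fst _)).
Qed.

Lemma is_diff_e2 x : is_diff x (@e2 R) (@e2 R).
Proof.
have dfst2 := is_diff_comp (is_diff_fst x) (is_diff_fst _).
exact: (is_diff_comp dfst2 (is_diff_snd _)).
Qed.

Lemma is_diff_p1 x : is_diff x (@p1 R) (@p1 R).
Proof. exact: (is_diff_comp (is_diff_fst _) (is_diff_snd _)). Qed.

Lemma is_diff_p2 x : is_diff x (@p2 R) (@p2 R).
Proof. exact: is_diff_snd. Qed.

Lemma is_diff_diffE (V W : normedModType R) (a : V) (f df : V -> W) v :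
  is_diff a f df -> 'd f a v = df v.
Proof. by move=> d; rewrite diff_val. Qed.

Lemma tangentE x X : tangent x X <->
  [/\ dot (e1 x) (e1 X) = 0, dot (e2 x) (e2 X) = 0,
      dot (e1 x) (e2 X) + dot (e1 X) (e2 x) = 0 &
  [/\ dot (e1 x) (p1 X) + dot (e1 X) (p1 x) = 0,
      dot (e2 x) (p2 X) + dot (e2 X) (p2 x) = 0 &
      dot (e1 x) (p2 X) + dot (e1 X) (p2 x)
        + (dot (e2 x) (p1 X) + dot (e2 X) (p1 x)) = 0]].
Proof.
have d1 := is_diff_e1 x; have d2 := is_diff_e2 x.
have dp1 := is_diff_p1 x; have dp2 := is_diff_p2 x.
have dC (c : R) : is_diff x (fun _ : phase R => c) (fun _ => 0)
  by exact: is_diff_cst.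
(* The bound proof [kE] stays a variable, so that the result applies to whatever ordinal a case
   analysis produces. *)
have dconstraint k kE f df : @constraint R (@Ordinal 6 k kE) = f ->
    is_diff x f df -> 'd (@constraint R (@Ordinal 6 k kE)) x X = df X.
  by move=> ->; exact: is_diff_diffE.
have c0 kE := @dconstraint 0 kE _ _ erefl (is_diffB (is_diff_dot d1 d1) (dC 1)).
have c1 kE := @dconstraint 1 kE _ _ erefl (is_diffB (is_diff_dot d2 d2) (dC 1)).
have c2 kE := @dconstraint 2 kE _ _ erefl (is_diff_dot d1 d2).
have c3 kE := @dconstraint 3 kE _ _ erefl (is_diff_dot d1 dp1).
have c4 kE := @dconstraint 4 kE _ _ erefl (is_diff_dot d2 dp2).
have c5 kE := @dconstraint 5 kE _ _ erefl
  (is_diffD (is_diff_dot d1 dp2) (is_diff_dot d2 dp1)).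
split=> [tX | [h0 h1 h2 [h3 h4 h5]]].
  have t k kE := tX (@Ordinal 6 k kE).
  split; last split.
  - have := t 0 isT; rewrite c0 !fctE subr0 [dot (e1 X) _]dotC; lra.
  - have := t 1 isT; rewrite c1 !fctE subr0 [dot (e2 X) _]dotC; lra.
  - by have := t 2 isT; rewrite c2.
  - by have := t 3 isT; rewrite c3.
  - by have := t 4 isT; rewrite c4.
  - by have := t 5 isT; rewrite c5.
case=> [[|[|[|[|[|[|//]]]]]] lt_k6].
- by rewrite c0 !fctE subr0 [dot (e1 X) _]dotC h0 addr0.
- by rewrite c1 !fctE subr0 [dot (e2 X) _]dotC h1 addr0.
- by rewrite c2.
- by rewrite c3.
- by rewrite c4.
- by rewrite c5.
Qed.

Lemma diff_hamiltonian (chi1 chi2 : R) (gam : 'cV[R]_3) x X :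
  'd (hamiltonian chi1 chi2 gam) x X =
  dot (p1 x) (p1 X) + dot (p2 x) (p2 X)
  - 3 * (dot (p1 x) (e2 X) + dot (p1 X) (e2 x)) * dot (p2 x) (e1 x)
  - 3 * dot (p1 x) (e2 x) * (dot (p2 x) (e1 X) + dot (p2 X) (e1 x))
  + (chi1 * dot gam (e1 X) + chi2 * dot gam (e2 X)).
Proof.
have d1 := is_diff_e1 x; have d2 := is_diff_e2 x.
have dp1 := is_diff_p1 x; have dp2 := is_diff_p2 x.
have dg : is_diff x (fun _ : phase R => gam) (fun _ => 0) by exact: is_diff_cst.
have dT1 := is_diffZ 2^-1 (is_diff_dot dp1 dp1).
have dT2 := is_diffZ 2^-1 (is_diff_dot dp2 dp2).
have dK := is_diffM (is_diffZ 3 (is_diff_dot dp1 d2)) (is_diff_dot dp2 d1).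
have dV1 := is_diffZ chi1 (is_diff_dot dg d1).
have dV2 := is_diffZ chi2 (is_diff_dot dg d2).
have d := is_diffD (is_diffB (is_diffD dT1 dT2) dK) (is_diffD dV1 dV2).
rewrite [LHS](is_diff_diffE X d) !fctE /= /GRing.scale /=.
rewrite !dot0l [dot (p1 X) (p1 x)]dotC [dot (p2 X) (p2 x)]dotC.
by field.
Qed.

End Differentials.

(** * The symplectic form and the Hamiltonian vector in body coordinates *)

Section HamiltonianVector.
Context {R : realType}.
Implicit Types (X Y : phase R) (Q : 'M[R]_3) (M m w u v gam : 'cV[R]_3).
Implicit Types (eta : R).

Lemma tangent_dphase_of Q M w m :
  SO3 Q -> tangent (phase_of Q M) (dphase_of Q M w m).
Proof.
move=> [QQ _]; apply/tangentE.
rewrite /dphase_of /phase_of /e1 /e2 /p1 /p2 /= !dot_orthogonal //.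
elim/(@col3_ind R): M => M1 M2 M3; elim/(@col3_ind R): w => w1 w2 w3.
elim/(@col3_ind R): m => m1 m2 m3.
rewrite !body_p1_col3 !body_p2_col3 !col3E.
by do ![split]; field.
Qed.

(** Linearized orthonormality leaves three free entries in the velocities of e1 and e2, which form
    w; the linearized momentum constraints leave three more, which form m. *)
Lemma tangent_phase_of Q M X : SO3 Q -> tangent (phase_of Q M) X ->
  exists w m, X = dphase_of Q M w m.
Proof.
move=> QSO3; have [QQ _] := QSO3.
have QE v : v = Q *m (Q^T *m v) by rewrite SO3_mulKV.
case: X => [[[a1 a2] b1] b2] /tangentE.
rewrite (QE a1) (QE a2) (QE b1) (QE b2).
rewrite /phase_of /dphase_of /e1 /e2 /p1 /p2 /= !dot_orthogonal //.
move: (Q^T *m a1) (Q^T *m a2) (Q^T *m b1) (Q^T *m b2) => {a1 a2 b1 b2}.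
elim/(@col3_ind R) => a1 a2 a3; elim/(@col3_ind R) => a1' a2' a3'.
elim/(@col3_ind R) => b1 b2 b3; elim/(@col3_ind R) => b1' b2' b3'.
elim/(@col3_ind R): M => M1 M2 M3.
rewrite body_p1_col3 body_p2_col3 !col3E => -[h1 h2 h3 [h4 h5 h6]].
have a1E : a1 = 0 by lra.
have a2E : a2' = 0 by lra.
have a12E : a1' = - a2 by lra.
subst a1 a2' a1'.
(* Read off from w x E1 = (0, w3, -w2) and w x E2 = (-w3, 0, w1); then m solves the equations for
   [b2], [b3] and [b3']. *)
exists (col3 a3' (- a3) a2).
exists (col3 (b3' + a3 * (M3 / 2)) (a3' * (M3 / 2) - b3) (2 * (b2 - a3' * M2))).
rewrite !body_p1_col3 !body_p2_col3 !col3E.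
by congr pair; [congr pair; [congr pair |] |]; congr mulmx; congr col3; lra.
Qed.

(** For eta = 0 this is the canonical form of T*SO(3) in the left trivialization. *)
Lemma omega_dphase_of eta Q M w m w' m' : SO3 Q ->
  omega eta (dphase_of Q M w m) (dphase_of Q M w' m') =
  dot m w' - dot m' w - dot (M + col3 0 0 (- eta)) (cross w w').
Proof.
move=> [QQ _].
rewrite /omega /dphase_of /e1 /e2 /p1 /p2 /= !dot_orthogonal //.
elim/(@col3_ind R): M => M1 M2 M3; elim/(@col3_ind R): w => w1 w2 w3.
elim/(@col3_ind R): m => m1 m2 m3; elim/(@col3_ind R): w' => w1' w2' w3'.
elim/(@col3_ind R): m' => m1' m2' m3'.
by rewrite !body_p1_col3 !body_p2_col3 !col3E; field.
Qed.

Lemma invmx_diag3_mul (a b c M1 M2 M3 : R) : a != 0 -> b != 0 -> c != 0 ->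
  invmx (diag3 a b c) *m col3 M1 M2 M3 =
  col3 (a^-1 * M1) (b^-1 * M2) (c^-1 * M3).
Proof.
move=> a0 b0 c0.
have diagE (p q r p' q' r' : R) :
    diag3 p q r *m col3 p' q' r' = col3 (p * p') (q * q') (r * r').
  apply/matrixP => i j; rewrite mul_diag_mx !mxE.
  by elim/forall_I3: i.
have unitD : diag3 a b c \in unitmx.
  rewrite unitmxE det_diag !big_ord_recl big_ord0 !mxE /= unitfE.
  by rewrite !mulf_neq0 // oner_eq0.
rewrite -[RHS](mulKmx unitD) diagE; congr (_ *m col3 _ _ _); by field.
Qed.

(** The squares contribute (M1^2 + M2^2)/2 + M3^2/4 and the mixed term 3 M3^2/4. The potential
    varies by chi.(Gamma x w) = (chi x Gamma).w. *)
Lemma diff_hamiltonian_dphase_of chi1 chi2 gam Q M w m : SO3 Q ->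
  'd (hamiltonian chi1 chi2 gam) (phase_of Q M) (dphase_of Q M w m) =
  dot (invmx (diag3 1 1 2^-1) *m M) m
  + dot (cross (col3 chi1 chi2 0) (Q^T *m gam)) w.
Proof.
move=> QSO3; have [QQ _] := QSO3.
have QE v : v = Q *m (Q^T *m v) by rewrite SO3_mulKV.
rewrite diff_hamiltonian {1 2}(QE gam).
rewrite /dphase_of /phase_of /e1 /e2 /p1 /p2 /= !dot_orthogonal //.
elim/(@col3_ind R): (Q^T *m gam) => g1 g2 g3.
elim/(@col3_ind R): M => M1 M2 M3; elim/(@col3_ind R): w => w1 w2 w3.
elim/(@col3_ind R): m => m1 m2 m3.
rewrite invmx_diag3_mul ?oner_eq0 ?invr_eq0 ?pnatr_eq0 //.
by rewrite !body_p1_col3 !body_p2_col3 !col3E; field.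
Qed.

Lemma hamiltonian_vectorP eta chi1 chi2 gam Q M X : SO3 Q ->
  let Omega := invmx (diag3 1 1 2^-1) *m M in
  hamiltonian_vector eta (hamiltonian chi1 chi2 gam) (phase_of Q M) X <->
  X = dphase_of Q M Omega
    (cross (M + col3 0 0 (- eta)) Omega + cross (Q^T *m gam) (col3 chi1 chi2 0)).
Proof.
move=> QSO3 Omega; set L := col3 0 0 (- eta); set chi := col3 chi1 chi2 0.
split=> [[tX hX]|->].
  have [w [m XE]] := tangent_phase_of QSO3 tX; rewrite {X}XE in tX hX *.
  have hX' w' m' := hX _ (tangent_dphase_of M w' m' QSO3).
  (* Vertical test vectors (0, m') isolate w. *)
  have wE : w = Omega.
    apply: dot_eq => m'; have := hX' 0 m'.
    rewrite omega_dphase_of // diff_hamiltonian_dphase_of // -/Omega.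
    rewrite cross0r ![dot _ 0]dotC !dot0l [dot m' w]dotC; lra.
  (* Test vectors (w', 0) isolate m, once the triple product is rearranged. *)
  subst w; congr dphase_of; apply: dot_eq => w'; have := hX' w' 0.
  rewrite omega_dphase_of // diff_hamiltonian_dphase_of // -/Omega -/chi -/L.
  rewrite dot0l [dot _ 0]dotC dot0l dot_cross dotDl [cross _ chi]crossC dotNl.
  lra.
split=> [|Y tY]; first exact: tangent_dphase_of.
have [w [m ->]] := tangent_phase_of QSO3 tY.
rewrite omega_dphase_of // diff_hamiltonian_dphase_of // -/Omega -/chi -/L.
rewrite dot_cross dotDl [cross _ chi]crossC dotNl [dot Omega m]dotC; ring.
Qed.

End HamiltonianVector.

(** * Calculus of vector- and matrix-valued derivatives *)

Section Derivatives.
Context {R : realType} {V : normedModType R}.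
Implicit Types (t v : V).

(** Existence and value of the derivative become one limit, which passes through projections and
    pairing. *)
Lemma is_deriveP (W : normedModType R) (f : V -> W) t v df :
  is_derive t v f df <->
  (fun h => h^-1 *: ((f \o shift t) (h *: v) - f t)) @ 0^' --> df.
Proof.
split=> [[fd <-]|fd]; first exact: fd.
by apply: DeriveDef; [apply/cvg_ex; exists df | exact: cvg_lim].
Qed.

Lemma is_derive_fst (U W : normedModType R) (f : V -> U * W) t v df :
  is_derive t v f df -> is_derive t v (fun s => (f s).1) df.1.
Proof.
move=> /is_deriveP fd; apply/is_deriveP.
have c : fst z @[z --> df] --> df.1 by exact: cvg_fst.
by have := cvg_comp _ _ fd c.
Qed.

Lemma is_derive_snd (U W : normedModType R) (f : V -> U * W) t v df :
  is_derive t v f df -> is_derive t v (fun s => (f s).2) df.2.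
Proof.
move=> /is_deriveP fd; apply/is_deriveP.
have c : snd z @[z --> df] --> df.2 by exact: cvg_snd.
by have := cvg_comp _ _ fd c.
Qed.

Lemma is_derive_pair (U W : normedModType R) (f : V -> U) (g : V -> W) t v
    df dg :
  is_derive t v f df -> is_derive t v g dg ->
  is_derive t v (fun s => (f s, g s)) (df, dg).
Proof.
move=> /is_deriveP fd /is_deriveP gd; apply/is_deriveP; exact: cvg_pair.
Qed.

Lemma is_derive_mxP m n (A : V -> 'M[R]_(m, n)) t v dA :
  is_derive t v A dA <->
  forall i j, is_derive t v (fun s => A s i j : R) (dA i j).
Proof.
split=> [[Ad <-] i j|Ad].
  apply: DeriveDef; first by move/derivable_mxP: Ad.
  by rewrite derive_mx // mxE.
have dA' : derivable A t v by apply/derivable_mxP => i j; case: (Ad i j).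
apply: DeriveDef => //; rewrite derive_mx //; apply/matrixP => i j.
by rewrite mxE; case: (Ad i j).
Qed.

Lemma is_derive_mulmx m n p (A : V -> 'M[R]_(m, n)) (B : V -> 'M[R]_(n, p))
    t v dA dB :
  is_derive t v A dA -> is_derive t v B dB ->
  is_derive t v (fun s => A s *m B s) (dA *m B t + A t *m dB).
Proof.
move=> /is_derive_mxP Ad /is_derive_mxP Bd; apply/is_derive_mxP => i j.
have -> : (fun s => (A s *m B s) i j : R) =
    \sum_k ((fun s => A s i k : R) * (fun s => B s k j : R)).
  by apply/funext => s; rewrite mxE fct_sumE.
apply: is_derive_eq (is_derive_sum (fun k => is_deriveM (Ad i k) (Bd k j))) _.
rewrite !mxE -big_split; apply: eq_bigr => k _.
by rewrite /= /GRing.scale /= addrC [dA i k * _]mulrC.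
Qed.

Lemma is_derive_trmx m n (A : V -> 'M[R]_(m, n)) t v dA :
  is_derive t v A dA -> is_derive t v (fun s => (A s)^T) dA^T.
Proof.
move=> /is_derive_mxP Ad; apply/is_derive_mxP => i j; rewrite mxE.
have -> : (fun s => (A s)^T i j : R) = (fun s => A s j i).
  by apply/funext => s; rewrite mxE.
exact: Ad.
Qed.

Lemma is_derive_cross (f g : V -> 'cV[R]_3) t v df dg :
  is_derive t v f df -> is_derive t v g dg ->
  is_derive t v (fun s => cross (f s) (g s)) (cross df (g t) + cross (f t) dg).
Proof.
move=> /is_derive_mxP fd /is_derive_mxP gd; apply/is_derive_mxP => i j.
have entry k l :
    is_derive t v (fun s => f s k 0 * g s l 0 - f s l 0 * g s k 0 : R)
      (df k 0 * g t l 0 + f t k 0 * dg l 0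
       - (df l 0 * g t k 0 + f t l 0 * dg k 0)).
  apply: is_derive_eq
    (is_deriveB (is_deriveM (fd k 0) (gd l 0)) (is_deriveM (fd l 0) (gd k 0))) _.
  by rewrite /GRing.scale /=; ring.
rewrite ord1 !mxE.
elim/forall_I3: i => /=.
- have -> : (fun s => cross (f s) (g s) 0 0 : R) =
      (fun s => f s 1 0 * g s 2 0 - f s 2 0 * g s 1 0).
    by apply/funext => s; rewrite mxE.
  by apply: is_derive_eq (entry 1 2) _; ring.
- have -> : (fun s => cross (f s) (g s) 1 0 : R) =
      (fun s => f s 2 0 * g s 0 0 - f s 0 0 * g s 2 0).
    by apply/funext => s; rewrite mxE.
  by apply: is_derive_eq (entry 2 0) _; ring.
- have -> : (fun s => cross (f s) (g s) 2 0 : R) =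
      (fun s => f s 0 0 * g s 1 0 - f s 1 0 * g s 0 0).
    by apply/funext => s; rewrite mxE.
  by apply: is_derive_eq (entry 0 1) _; ring.
Qed.

End Derivatives.

(** * Velocities of curves in T*V in body coordinates *)

Section Curves.
Context {R : realType}.
Implicit Types (x : R -> phase R) (t : R) (Q : 'M[R]_3) (M m w : 'cV[R]_3).

Lemma is_derive_frame x t w m :
  TstarV (x t) ->
  is_derive t 1 x (dphase_of (frame (x t)) (body_momentum (x t)) w m) ->
  is_derive t 1 (fun s => frame (x s)) (frame (x t) *m hat w).
Proof.
move=> Vx xd; have QSO3 := frame_SO3 Vx; set Q := frame (x t) in xd QSO3 *.
have de1 := is_derive_fst (is_derive_fst (is_derive_fst xd)).
have de2 := is_derive_snd (is_derive_fst (is_derive_fst xd)).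
have de3 := is_derive_cross de1 de2.
rewrite /= -/(e1 (x t)) -/(e2 (x t)) frame_e1 frame_e2 -/Q in de3.
rewrite !cross_SO3 // -mulmxDr in de3.
apply/is_derive_mxP => i j; have coln0 (A : 'M[R]_3) :
  [/\ (A *m col3 1 0 0) i 0 = A i 0, (A *m col3 0 1 0) i 0 = A i 1
    & (A *m col3 0 0 1) i 0 = A i 2].
  by rewrite !mulmx_col3 !mxE; split; ring.
elim/forall_I3: j.
- have -> : (fun s => frame (x s) i 0 : R) = (fun s => e1 (x s) i 0).
    by apply/funext => s; rewrite mxE.
  have [<- _ _] := coln0 (Q *m hat w); rewrite -mulmxA hatE.
  exact: (is_derive_mxP _ _ _ _).1 de1 _ _.
- have -> : (fun s => frame (x s) i 1 : R) = (fun s => e2 (x s) i 0).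
    by apply/funext => s; rewrite mxE.
  have [_ <- _] := coln0 (Q *m hat w); rewrite -mulmxA hatE.
  exact: (is_derive_mxP _ _ _ _).1 de2 _ _.
- have -> : (fun s => frame (x s) i 2 : R) = (fun s => e3 (x s) i 0).
    by apply/funext => s; rewrite mxE.
  have [_ _ <-] := coln0 (Q *m hat w); rewrite -mulmxA hatE.
  (* The Jacobi identity for w, E1, E2, with E3 = E1 x E2. *)
  have -> : cross w (col3 0 0 1) = cross (cross w (col3 1 0 0)) (col3 0 1 0)
      + cross (col3 1 0 0) (cross w (col3 0 1 0)).
    elim/(@col3_ind R): (w) => a b c; rewrite !col3E; congr col3; ring.
  exact: (is_derive_mxP _ _ _ _).1 de3 _ _.
Qed.

(** The linear formula [body_momentumE] holds on T*V, so the curve is taken to stay there near t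
    before the formula is differentiated. *)
Lemma is_derive_body_momentum x t w m :
  (\forall s \near t, TstarV (x s)) ->
  is_derive t 1 x (dphase_of (frame (x t)) (body_momentum (x t)) w m) ->
  is_derive t 1 (fun s => body_momentum (x s)) m.
Proof.
move=> nearV xd; have Vx := nbhs_singleton nearV.
have QSO3 := frame_SO3 Vx; have [QQ _] := QSO3.
have dFT := is_derive_trmx (is_derive_frame Vx xd).
have dp1 := is_derive_mulmx dFT (is_derive_snd (is_derive_fst xd)).
have dp2 := is_derive_mulmx dFT (is_derive_snd xd).
have xE := phase_of_body Vx.
(* Moving with the frame does not change the body coordinates of p1, p2.     *)
have rate u v : (frame (x t) *m hat w)^T *m (frame (x t) *m u)
    + (frame (x t))^T *m (frame (x t) *m (cross w u + v)) = v.
  rewrite trmx_mul hatT !mulNmx -mulmxA !(mulmxA (frame (x t))^T) QQ !mul1mx.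
  by rewrite hatE addKr.
rewrite /= -{2}xE rate in dp1; rewrite /= -{2}xE rate in dp2.
have dE u := is_derive_cst (hat u) t (1 : R).
have dM := is_deriveD (is_derive_mulmx (dE (col3 1 0 0)) dp1)
                      (is_derive_mulmx (dE (col3 0 1 0)) dp2).
rewrite !mul0mx !add0r !hatE in dM.
have <- : cross (col3 1 0 0) (body_p1 m) + cross (col3 0 1 0) (body_p2 m) = m.
  elim/(@col3_ind R): (m) => a b c; rewrite body_p1_col3 body_p2_col3 !col3E.
  by congr col3; field.
apply: near_eq_is_derive dM.
near=> s; rewrite [RHS]body_momentumE -?hatE //; near: s; exact: nearV.
Unshelve. all: by end_near. Qed.

(** Near t the curve equals [phase_of] of its frame and body momentum, and the product rule applies
    to that expression. *)
Lemma is_derive_phase x t w m :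
  (\forall s \near t, TstarV (x s)) ->
  is_derive t 1 (fun s => frame (x s)) (frame (x t) *m hat w) ->
  is_derive t 1 (fun s => body_momentum (x s)) m ->
  is_derive t 1 x (dphase_of (frame (x t)) (body_momentum (x t)) w m).
Proof.
move=> nearV dF dM.
have dcomp (u : R -> 'cV[R]_3) du : is_derive t 1 u du ->
    is_derive t 1 (fun s => frame (x s) *m u s)
      (frame (x t) *m (cross w (u t) + du)).
  by move=> ud; rewrite mulmxDr -hatE mulmxA; exact: is_derive_mulmx.
have Md := (is_derive_mxP _ _ _ _).1 dM.
have dP1 : is_derive t 1 (fun s => body_p1 (body_momentum (x s))) (body_p1 m).
  apply/is_derive_mxP => i j; rewrite mxE.
  elim/forall_I3: i => /=.
  - apply: near_eq_is_derive (is_derive_cst 0 t (1 : R)).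
    by near=> s; rewrite [RHS]mxE.
  - have -> : m 2 0 / 2 = 2^-1 *: (m 2 0 : R^o) by rewrite mulrC.
    apply: near_eq_is_derive (is_deriveZ 2^-1 (Md 2 0)).
    by near=> s; rewrite [RHS]mxE /= mulrC.
  - apply: near_eq_is_derive (is_deriveN (Md 1 0)).
    by near=> s; rewrite [RHS]mxE.
have dP2 : is_derive t 1 (fun s => body_p2 (body_momentum (x s))) (body_p2 m).
  apply/is_derive_mxP => i j; rewrite mxE.
  elim/forall_I3: i => /=.
  - have -> : - (m 2 0 / 2) = (- 2^-1) *: (m 2 0 : R^o).
      by rewrite mulrC -mulNr.
    apply: near_eq_is_derive (is_deriveZ (- 2^-1) (Md 2 0)).
    by near=> s; rewrite [RHS]mxE /= mulrC -mulNr.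
  - apply: near_eq_is_derive (is_derive_cst 0 t (1 : R)).
    by near=> s; rewrite [RHS]mxE.
  - apply: near_eq_is_derive (Md 0 0).
    by near=> s; rewrite [RHS]mxE.
have dE u : is_derive t 1 (fun s => frame (x s) *m u) (frame (x t) *m cross w u).
  by have := dcomp _ _ (is_derive_cst u t (1 : R)); rewrite addr0.
have d := is_derive_pair (is_derive_pair (is_derive_pair (dE (col3 1 0 0))
  (dE (col3 0 1 0))) (dcomp _ _ dP1)) (dcomp _ _ dP2).
apply: near_eq_is_derive d.
near=> s; apply: phase_of_body; near: s; exact: nearV.
Unshelve. all: by end_near. Qed.

End Curves.

(** * Equivalence of the Hamiltonian flow and the Euler-Poisson equations *)

Theorem proposition3 (R : realType) (eta chi1 chi2 : R) (gam : 'cV[R]_3) :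
  dot gam gam = 1 ->
  let H := hamiltonian chi1 chi2 gam in
  [/\ set_bij (@TstarV R) (@SO3 R `*` [set: 'cV[R]_3])
        (fun x => (frame x, body_momentum x)),
      forall x, TstarV x -> exists! X, hamiltonian_vector eta H x X
    & forall (J : set R) (x : R -> phase R),
        open J -> (forall t, J t -> TstarV (x t)) ->
        integral_curve eta H J x <->
        heavy_gyrostat_motion (diag3 1 1 2^-1)
          (col3 0 0 (- eta)) (col3 chi1 chi2 0) gam J
          (fun t => frame (x t)) (fun t => body_momentum (x t))].
Proof.
move=> _ H; split.
- split=> [x Vx | x y /set_mem Vx /set_mem Vy [frameE bodyE] | [Q M] [QSO3 _]].
  + by split=> //=; exact: frame_SO3.
  + by rewrite -(phase_of_body Vx) -(phase_of_body Vy) frameE bodyE.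
  + exists (phase_of Q M); first exact: TstarV_phase_of.
    by rewrite frame_phase_of // body_momentum_phase_of.
- move=> x Vx; have QSO3 := frame_SO3 Vx; rewrite -(phase_of_body Vx).
  eexists; split; first by apply/hamiltonian_vectorP.
  by move=> X /hamiltonian_vectorP ->.
- move=> J x openJ VJ; split=> [curve Omega Gamma t Jt | motion t Jt].
    have nearV : \forall s \near t, TstarV (x s).
      by apply: filterS (open_nbhs_nbhs (conj openJ Jt)).
    have Vx := VJ t Jt; have QSO3 := frame_SO3 Vx.
    have [xd] := curve t Jt; rewrite -{1}(phase_of_body Vx).
    move=> /(hamiltonian_vectorP eta chi1 chi2 gam _ _ QSO3) DE.
    have xD := derivableP xd; rewrite DE in xD.
    have dF := is_derive_frame Vx xD.
    split=> //; first exact: is_derive_body_momentum xD.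
    (* The equation for Gamma: (Q hat Omega)^T gam = - Omega x Gamma, since [hat] is skew. *)
    have := is_derive_mulmx (is_derive_trmx dF) (is_derive_cst gam t (1 : R)).
    by rewrite mulmx0 addr0 trmx_mul hatT !mulNmx -mulmxA hatE -crossC.
  have nearV : \forall s \near t, TstarV (x s).
    by apply: filterS (open_nbhs_nbhs (conj openJ Jt)).
  have Vx := VJ t Jt; have QSO3 := frame_SO3 Vx.
  have [dF dM _] := motion t Jt.
  have [xd DE] := is_derive_phase nearV dF dM.
  split=> //; rewrite DE -{1}(phase_of_body Vx).
  exact/hamiltonian_vectorP.
Qed.
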